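(* Let $G$ be a simple graph of order $n$ with minimum degree $\delta=\delta(G)$. If $\delta\ge \frac{2n}{3}$, then every integer root of the total domination polynomial $D_t(G,x)$ lies in the set $\{-3,-2,-1,0\}$.
   Context: Graphs are finite and simple; the order of a graph is its number of vertices. For a graph $G=(V,E)$ of order $n$, a set $D\subseteq V$ is a total dominating set if every vertex of $V$ is adjacent to some vertex of $D$. Let $d_t(G,i)$ be the number of total dominating sets of $G$ of cardinality $i$. The total domination polynomial of $G$ is $D_t(G,x)=\sum_{i=1}^n d_t(G,i)x^i$. *)

(* Defs.v *)
From mathcomp Require Import all_boot all_order all_algebra.

Set Implicit Arguments.
Unset Strict Implicit.
Unset Printing Implicit Defensive.

Import Order.TTheory GRing.Theory Num.Theory.

Record sgraph := SGraph {
  vertex :> finType;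
  adj : rel vertex;
  adj_sym : symmetric adj;
  adj_irr : irreflexive adj
}.

Definition graph_order (G : sgraph) : nat := #|{: G}|.

Definition degree (G : sgraph) (v : G) : nat := #|[set u : G | adj v u]|.

(* The default value [graph_order G] exceeds every degree, so it is never attained
   on a graph with at least one vertex. *)
Definition min_degree (G : sgraph) : nat :=
  \big[minn/graph_order G]_(v : G) degree v.

Definition total_dominating (G : sgraph) (D : {set G}) : bool :=
  [forall v : G, exists u : G, (u \in D) && adj v u].

Definition dt (G : sgraph) (i : nat) : nat :=
  #|[set D : {set G} | total_dominating D && (#|D| == i)]|.

Local Open Scope ring_scope.

Definition total_domination_poly (G : sgraph) : {poly int} :=
  \sum_(1 <= i < (graph_order G).+1) (dt G i)%:R *: 'X^i.

(* Main.v *)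
Require Import Defs.
From mathcomp Require Import all_boot all_order all_algebra.
From mathcomp Require Import zify.

Set Implicit Arguments.
Unset Strict Implicit.
Unset Printing Implicit Defensive.

Import Order.TTheory GRing.Theory Num.Theory.
Local Open Scope ring_scope.

(** Write [m := n - delta]; the hypothesis says [3 * m <= n].  A set that is not
    total dominating misses the whole neighbourhood of some vertex, so it has at
    most [m] elements.  Hence [dt G i] is the binomial coefficient ['C(n, i)] for
    every [i > m], and [D_t(G, x)] differs from [(1 + x)^n] by a polynomial of
    degree at most [m] whose coefficients lie between [0] and ['C(n, i)]
    ([total_domination_polyE], [dt_le_bin]).

    At a root [x = - y] with [y >= 4] this gives
    [(y - 1)^n <= \sum_(i <= m) 'C(n, i) y^i].  A Chernoff-type estimate
    ([binomial_head_lt]) shows the reverse strict inequality: weighting the [i]-th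
    term by [(2 y)^(m - i) >= 1] bounds the sum strictly by
    [(2 y)^m (1 + 1/2)^n], and this is at most [(y - 1)^n] because [3 * m <= n]
    and [27 y <= 4 (y - 1)^3] for [y >= 4].  The last inequality is an equality at
    [y = 4], so the estimate reaches down exactly to [y = 4].

    Positive roots are excluded since the coefficients are nonnegative and the
    full vertex set is total dominating. *)

(** The cubic condition behind the threshold [4], raised to the power [m]; the
    [n - 3 * m] leftover factors only need [3 <= 2 * (y - 1)]. *)
Lemma chernoff_base_le (n m y : nat) : (4 <= y)%N -> (3 * m <= n)%N ->
  ((2 * y) ^ m * 3 ^ n <= (2 * y.-1) ^ n)%N.
Proof.
move=> y4 le3mn; rewrite -(subnKC le3mn)
  !(expnD _ (3 * m)) !(expnM _ 3 m) mulnA -expnMn.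
apply: leq_mul; last first.
  case: (posnP (n - 3 * m)) => [->|pos]; first by rewrite !expn0.
  by rewrite leq_exp2r //; lia.
case: (posnP m) => [->|m_gt0]; first by rewrite !expn0.
have [k ->] : exists k, y = k.+4 by exists (y - 4)%N; lia.
by rewrite leq_exp2r //= !expnS expn0; nia.
Qed.

(** A lower tail of the binomial expansion of [(1 + y)^n] is dominated by
    [(y - 1)^n], by Chernoff's method with the weight [1 / (2 y)], which
    minimises the exponential bound at [m = n / 3]. *)
Lemma binomial_head_lt (n m y : nat) : (0 < n)%N -> (4 <= y)%N ->
  (3 * m <= n)%N ->
  (\sum_(i < n.+1 | i <= m) 'C(n, i) * y ^ i < y.-1 ^ n)%N.
Proof.
move=> n_gt0 y4 le3mn; have lt_mn : (m < n)%N by lia.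
rewrite -(@ltn_pmul2l (2 ^ n)) ?expn_gt0 // -expnMn.
apply: leq_trans (chernoff_base_le y4 le3mn).
have le_weighted : (2 ^ n * (\sum_(i < n.+1 | i <= m) 'C(n, i) * y ^ i) <=
    (2 * y) ^ m * \sum_(i < n.+1 | i <= m) 'C(n, i) * 2 ^ (n - i))%N.
  rewrite !big_distrr /=; apply: leq_sum => i le_im.
  rewrite mulnCA [leqRHS]mulnCA leq_mul2l; apply/orP; right.
  have le_in : (i <= n)%N by rewrite -ltnS.
  rewrite -{1}(subnKC le_in) expnD mulnAC -expnMn leq_mul2r.
  by rewrite leq_pexp2l ?orbT //; lia.
apply: leq_ltn_trans le_weighted _; rewrite ltn_pmul2l ?expn_gt0; last by lia.
have -> : (3 ^ n = \sum_(i < n.+1) 'C(n, i) * 2 ^ (n - i))%N.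
  rewrite -[3%N]/(2 + 1)%N expnDn; apply: eq_bigr => i _.
  by rewrite exp1n muln1.
(* Strictness comes from the top term, which is outside the head as [m < n]. *)
rewrite [ltnRHS](bigID (fun i : 'I_n.+1 => (i <= m)%N)) /= -addn1 leq_add2l.
by rewrite (bigD1 ord_max) /= -?ltnNge // binn subnn.
Qed.

Lemma min_degree_le (G : sgraph) (v : G) : (min_degree G <= degree v)%N.
Proof.
rewrite /min_degree; have : v \in index_enum G by rewrite mem_index_enum.
elim: (index_enum G) => // w s IHs; rewrite inE big_cons geq_min.
by case/predU1P => [->|/IHs->]; rewrite ?leqnn ?orbT.
Qed.

(** Two sets whose sizes add up to more than [n] intersect; apply this to a set
    and the neighbourhood of each vertex. *)
Lemma large_total_dominating (G : sgraph) (D : {set G}) :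
  (graph_order G < #|D| + min_degree G)%N -> total_dominating D.
Proof.
move=> ltD; apply/forallP => v; apply/existsP.
have ltDv : (graph_order G < #|D| + degree v)%N.
  by apply: leq_trans ltD _; rewrite leq_add2l min_degree_le.
have : (0 < #|D :&: [set u | adj v u]|)%N.
  have := cardsUI D [set u | adj v u]; have := max_card (D :|: [set u | adj v u]).
  by move: ltDv; rewrite /graph_order /degree; lia.
by case/card_gt0P => u; rewrite !inE => uP; exists u.
Qed.

Lemma dt_large (G : sgraph) (i : nat) :
  (graph_order G < i + min_degree G)%N -> dt G i = 'C(graph_order G, i).
Proof.
move=> lti; rewrite /dt /graph_order -card_draws; apply: eq_card => D.
rewrite !inE; case: eqP => [Di|_]; last by rewrite andbF.
by rewrite large_total_dominating ?Di.
Qed.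

Lemma dt_le_bin (G : sgraph) (i : nat) : (dt G i <= 'C(graph_order G, i))%N.
Proof.
rewrite /dt /graph_order -card_draws; apply: subset_leq_card.
by apply/subsetP => D; rewrite !inE => /andP[].
Qed.

Lemma dt0 (G : sgraph) : (0 < graph_order G)%N -> dt G 0 = 0%N.
Proof.
case/card_gt0P => v _; apply: eq_card0 => D; rewrite !inE.
apply/negP => /andP[/forallP/(_ v)/existsP[u /andP[uD _]]].
by rewrite cards_eq0 => /eqP D0; rewrite D0 inE in uD.
Qed.

Lemma horner_total_domination (G : sgraph) (z : int) : (0 < graph_order G)%N ->
  (total_domination_poly G).[z] =
    \sum_(i < (graph_order G).+1) (dt G i)%:R * z ^+ i.
Proof.
move=> G_gt0; rewrite /total_domination_poly horner_sum.
rewrite -(big_mkord xpredT (fun i => (dt G i)%:R * z ^+ i)).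
rewrite [RHS]big_ltn // dt0 // mul0r add0r.
by apply: eq_bigr => i _; rewrite hornerZ hornerXn.
Qed.

(** The coefficients of [(1 + x)^n] and of the total domination polynomial agree
    above degree [n - delta]; the correction counts the sets that are not total
    dominating. *)
Lemma total_domination_polyE (G : sgraph) (z : int) : (0 < graph_order G)%N ->
  (total_domination_poly G).[z] = (1 + z) ^+ graph_order G -
    \sum_(i < (graph_order G).+1 | (i <= graph_order G - min_degree G)%N)
      ('C(graph_order G, i) - dt G i)%:R * z ^+ i.
Proof.
move=> G_gt0; rewrite horner_total_domination // exprDn [X in _ - X]big_mkcond /=.
rewrite -sumrB; apply: eq_bigr => i _; rewrite expr1n mul1r -[_ *+ _ in RHS]mulr_natl.
case: leqP => [_|lti]; last by rewrite subr0 dt_large //; lia.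
by rewrite natrB ?dt_le_bin // -mulrBl subKr.
Qed.

Lemma total_domination_poly_gt0 (G : sgraph) (z : int) :
  (0 < graph_order G)%N -> (0 < min_degree G)%N -> 0 < z ->
  0 < (total_domination_poly G).[z].
Proof.
move=> G_gt0 d_gt0 z_gt0; rewrite horner_total_domination // big_ord_recr /=.
rewrite dt_large ?binn; last by lia.
rewrite mul1r ltr_wpDl ?exprn_gt0 //; apply: sumr_ge0 => i _.
by rewrite mulr_ge0 ?ler0n // exprn_ge0 // ltW.
Qed.

Lemma total_domination_poly_neq0 (G : sgraph) (y : nat) :
  (0 < graph_order G)%N -> (2 * graph_order G <= 3 * min_degree G)%N ->
  (4 <= y)%N -> (total_domination_poly G).[- y%:R] != 0.
Proof.
move=> G_gt0 led y4; rewrite total_domination_polyE // subr_eq0.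
set n := graph_order G in G_gt0 led *; set m := (n - min_degree G)%N.
have le3mn : (3 * m <= n)%N by rewrite /m; lia.
have := binomial_head_lt G_gt0 y4 le3mn; rewrite -(ltr_nat int) natrX natr_sum.
apply: contraTneq => eq_head; rewrite -leNgt.
have -> : y.-1%:R ^+ n = `|(1 - y%:R) ^+ n| :> int.
  rewrite normrX distrC -{2}(prednK (ltnW (ltnW (ltnW y4)))).
  by rewrite -natr1 addrK ger0_norm ?ler0n.
rewrite eq_head; apply: le_trans (ler_norm_sum _ _ _) _; apply: ler_sum => i _.
rewrite normrM normrX normrN !normr_nat natrM natrX ler_wpM2r ?exprn_ge0 //.
by rewrite ler_nat leq_subr.
Qed.

Theorem corollary3p3 (G : sgraph) (n : nat)
    (n_gt0 : (0 < n)%N) (orderG : graph_order G = n)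
    (min_deg : (2 * n%:R) / 3 <= (min_degree G)%:R :> rat)
    (z : int) (rootz : root (total_domination_poly G) z) :
  z \in [:: -3; -2; -1; 0].
Proof.
have led : (2 * graph_order G <= 3 * min_degree G)%N.
  move: min_deg; rewrite orderG ler_pdivrMr // mulrC -!natrM ler_nat.
  by rewrite mulnC (mulnC 3).
have G_gt0 : (0 < graph_order G)%N by rewrite orderG.
move/rootP: rootz => rootz.
have z_le0 : z <= 0.
  rewrite leNgt; apply/negP => z_gt0.
  have d_gt0 : (0 < min_degree G)%N by lia.
  by have := total_domination_poly_gt0 G_gt0 d_gt0 z_gt0; rewrite rootz ltxx.
have lt_z4 : (`|z| < 4)%N.
  rewrite ltnNge; apply/negP => z4.
  have := total_domination_poly_neq0 G_gt0 led z4.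
  have -> : - `|z|%N%:R = z by rewrite natz; lia.
  by rewrite rootz eqxx.
by rewrite !inE; lia.
Qed.
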